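(* Let $\prec$ be an exposure order on $F$ and let $I\leq\mathcal{A}=K[F]$ be a right ideal. The exposure basis $B_{I,\prec}$ is a basis for $I$ (as a free right $\mathcal{A}$-module).
   Context: $K$ is a field, $F$ is a free group with finite basis $S$ (elements are reduced words in $S\cup S^{-1}$; $e$ is the identity), and $\mathcal{A}=K[F]$. The support $\mathrm{supp}(f)$ of $f\in\mathcal{A}$ is the set of words with nonzero coefficient in $f$; $f$ is supported on $T\subseteq F$ if $\mathrm{supp}(f)\subseteq T$. $\mathrm{Sp}_K(T)$ is the $K$-span of $T$. ''Ideal'' means right ideal. An exposure order on $F$ is a well-order $\prec$ on $F$ such that $u\preceq v$ whenever $u$ is a prefix of $v$. For distinct subsets $A,B\subseteq F$: $A\prec_{\min}B$ if $\min(A\triangle B)\in A$ (a total order on subsets). For distinct finite subsets $A,B\subseteq F$: $A\prec_{\max}B$ if $\max(A\triangle B)\in B$ (a well-order on finite subsets). For $0\ne f\in\mathcal{A}$, the head term $\mathrm{HT}(f)$ is the $\prec$-maximal word in $\mathrm{supp}(f)$; $f$ is monic if the coefficient of $\mathrm{HT}(f)$ in $f$ is $1$. A Schreier transversal for $I$ is a prefix-closed subset $T\subseteq F$ such that $\mathrm{Sp}_K(T)\cap I=\{0\}$ and every $I$-coset in $\mathcal{A}$ intersects $\mathrm{Sp}_K(T)$. The set of Schreier transversals for $I$ has a minimum with respect to $\prec_{\min}$, denoted $T_I=T_{I,\prec}$. Exposure process of $I$: define elements $f_\alpha\in I$ by transfinite recursion on ordinals $\alpha$. Given $f_\beta$ for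 all $\beta<\alpha$, let $I_\alpha$ be the right ideal generated by $\{f_\beta:\beta<\alpha\}$. If $I_\alpha=I$, stop and set $\omega_I:=\alpha$. Otherwise let $f_\alpha$ be the unique monic element of $I$ whose support is $\prec_{\max}$-minimal among the monic elements of $I$ supported on $T_{I_\alpha}$ (such an element exists and is unique, and the process always stops). The exposure basis of $I$ is $B_{I,\prec}=\{f_\alpha:\alpha<\omega_I\}$. *)

(* Defs.v *)
From HB Require Import structures.
From mathcomp Require Import all_boot all_order all_algebra.
From mathcomp Require Import boolp classical_sets wochoice.
From mathcomp Require Import finmap.
From mathcomp Require Import monalg.

Set Implicit Arguments.
Unset Strict Implicit.
Unset Printing Implicit Defensive.

Import GRing.Theory.
Local Open Scope ring_scope.

Section FreeGroup.
Variable S : finType.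

(* [(s, true)] stands for the generator [s] and [(s, false)] for its inverse. *)
Definition letter : Type := (S * bool)%type.
Definition linv (a : letter) : letter := (a.1, ~~ a.2).
Definition reduced (w : seq letter) : bool :=
  sorted (fun a b => b != linv a) w.

Record free_group : predArgType :=
  FreeWord { fword : seq letter; fwordP : reduced fword }.
HB.instance Definition _ := [isSub for fword].
HB.instance Definition _ := [Choice of free_group by <:].

(* Left multiplication of a reduced word by one letter, with cancellation. *)
Definition push (a : letter) (w : seq letter) : seq letter :=
  if w is b :: w' then if b == linv a then w' else a :: w else [:: a].
Definition wmul (u v : seq letter) : seq letter := foldr push v u.
Definition winv (u : seq letter) : seq letter := rev (map linv u).

Lemma linvK : involutive linv.
Proof. by case=> s b; rewrite /linv negbK. Qed.

Lemma reduced_behead a w : reduced (a :: w) -> reduced w.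
Proof. exact: path_sorted. Qed.

Lemma push_reduced a w : reduced w -> reduced (push a w).
Proof.
case: w => [//|b w] rw /=; case: ifP => [_|/negbT ba].
  exact: reduced_behead rw.
by rewrite /reduced /= ba.
Qed.

Lemma pushK a w : reduced w -> push (linv a) (push a w) = w.
Proof.
case: w => [_|b w] /=; first by rewrite linvK eqxx.
case: ifP => [/eqP ->|_] rw; last by rewrite /= linvK eqxx.
case: w rw => [//|c w] /= /andP[/negbTE]; rewrite linvK => + _.
by move=> ->.
Qed.

Lemma wmul_reduced u v : reduced v -> reduced (wmul u v).
Proof. by move=> rv; elim: u => //= a u; apply: push_reduced. Qed.

Lemma wmul_push a u w :
  reduced w -> wmul (push a u) w = push a (wmul u w).
Proof.
move=> rw; case: u => [//|b u] /=; case: eqP => [->|//].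
by rewrite -{1}[a]linvK pushK // wmul_reduced.
Qed.

Lemma wmulA u v w : reduced w -> wmul u (wmul v w) = wmul (wmul u v) w.
Proof. by move=> rw; elim: u => //= a u ->; rewrite wmul_push. Qed.

Lemma wmul1 u : reduced u -> wmul u [::] = u.
Proof.
elim: u => //= a u IHu ru; rewrite IHu ?(reduced_behead ru) //.
by case: u ru {IHu} => //= b u /andP[/negbTE ->].
Qed.

Lemma winvK : involutive winv.
Proof. by move=> u; rewrite /winv map_rev revK mapK //; apply: linvK. Qed.

Lemma winv_reduced u : reduced u -> reduced (winv u).
Proof.
rewrite /reduced /winv rev_sorted sorted_map; apply: sub_sorted => a b /=.
by rewrite linvK; apply: contra => /eqP ->.
Qed.

Lemma wmulVK u w : reduced w -> wmul (winv u) (wmul u w) = w.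
Proof.
move=> rw; rewrite /wmul /winv; elim: u => //= a u IHu.
by rewrite rev_cons foldr_rcons pushK // wmul_reduced.
Qed.

Definition fg_one : free_group := @FreeWord [::] isT.
Definition fg_mul (u v : free_group) : free_group :=
  FreeWord (wmul_reduced (fword u) (fwordP v)).
Definition fg_inv (u : free_group) : free_group :=
  FreeWord (winv_reduced (fwordP u)).

Lemma fg_mulA : associative fg_mul.
Proof. by move=> u v w; apply/val_inj/wmulA/fwordP. Qed.
Lemma fg_mul1g : left_id fg_one fg_mul.
Proof. by move=> u; apply/val_inj. Qed.
Lemma fg_mulg1 : right_id fg_one fg_mul.
Proof. by move=> u; apply/val_inj/wmul1/fwordP. Qed.
Lemma fg_mulVg : left_inverse fg_one fg_inv fg_mul.
Proof.
move=> u; apply/val_inj => /=.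
by rewrite -[X in wmul _ X](wmul1 (fwordP u)) wmulVK.
Qed.
Lemma fg_mulgV : right_inverse fg_one fg_inv fg_mul.
Proof.
move=> u; apply/val_inj => /=; rewrite -[in X in wmul X _](winvK (fword u)).
by rewrite -[X in wmul _ X](wmul1 (winv_reduced (fwordP u))) wmulVK.
Qed.

HB.instance Definition _ := isGroup.Build free_group
  fg_mulA fg_mul1g fg_mulg1 fg_mulVg fg_mulgV.

End FreeGroup.

(* The ring structure that [monalg] puts on [{malg K[G]}] requires [G] to have *)
(* no nontrivial units, so the group algebra is an alias of [{malg K[G]}] that *)
(* keeps its vector space structure and carries its own product.               *)
Definition group_algebra (G : groupType) (K : comNzRingType) : Type :=
  {malg K[G]}.

Section GroupAlgebra.
Variables (G : groupType) (K : comNzRingType).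
Local Notation A := (group_algebra G K).
Implicit Types (f g h : {malg K[G]}) (k : G) (c : K).
Local Open Scope fset_scope.

HB.instance Definition _ := GRing.Lmodule.copy A {malg K[G]}.

Definition ga_one : {malg K[G]} := << 1 *g 1%g >>.
Definition ga_mul f g : {malg K[G]} :=
  \sum_(k1 <- msupp f) \sum_(k2 <- msupp g)
    << f@_k1 * g@_k2 *g (k1 * k2)%g >>.

Lemma ga_mulw (d1 d2 : {fset G}) f g : msupp f `<=` d1 -> msupp g `<=` d2 ->
  ga_mul f g = \sum_(k1 <- d1) \sum_(k2 <- d2)
    << f@_k1 * g@_k2 *g (k1 * k2)%g >>.
Proof.
move=> le_d1 le_d2; rewrite /ga_mul (big_fset_incl _ le_d1) /=.
  apply/eq_bigr=> k1 _; apply/big_fset_incl => // k _ /mcoeff_outdom ->.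
  by rewrite mulr0 monalgU0.
move=> k _ /mcoeff_outdom fk.
by rewrite big1 => // k' _; rewrite fk mul0r monalgU0.
Qed.

Lemma ga_mul0g : left_zero 0 ga_mul.
Proof. by move=> g; rewrite /ga_mul msupp0 big_seq_fset0. Qed.

Lemma ga_mulg0 : right_zero 0 ga_mul.
Proof.
by move=> g; rewrite /ga_mul big1 // => k _; rewrite msupp0 big_seq_fset0.
Qed.

Lemma ga_mulDl : left_distributive ga_mul +%R.
Proof.
move=> f1 f2 g.
rewrite (ga_mulw (fsubsetUl (msupp f1) (msupp f2)) (fsubset_refl (msupp g))).
rewrite (ga_mulw (fsubsetUr (msupp f1) (msupp f2)) (fsubset_refl (msupp g))).
rewrite (ga_mulw (msuppD_le f1 f2) (fsubset_refl (msupp g))) -big_split /=.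
apply/eq_bigr=> k1 _; rewrite -big_split /=; apply/eq_bigr=> k2 _.
by rewrite mcoeffD mulrDl monalgUD.
Qed.

Lemma ga_mulDr : right_distributive ga_mul +%R.
Proof.
move=> f g1 g2.
rewrite (ga_mulw (fsubset_refl (msupp f)) (fsubsetUl (msupp g1) (msupp g2))).
rewrite (ga_mulw (fsubset_refl (msupp f)) (fsubsetUr (msupp g1) (msupp g2))).
rewrite (ga_mulw (fsubset_refl (msupp f)) (msuppD_le g1 g2)) -big_split /=.
apply/eq_bigr=> k1 _; rewrite -big_split /=; apply/eq_bigr=> k2 _.
by rewrite mcoeffD mulrDr monalgUD.
Qed.

Lemma ga_mulUU c1 c2 k1 k2 :
  ga_mul << c1 *g k1 >> << c2 *g k2 >> = << c1 * c2 *g (k1 * k2)%g >>.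
Proof. by rewrite (ga_mulw msuppU_le msuppU_le) !big_seq_fset1 !mcoeffUU. Qed.

Lemma ga_mul_suml (I : Type) (r : seq I) (F : I -> {malg K[G]}) g :
  ga_mul (\sum_(i <- r) F i) g = \sum_(i <- r) ga_mul (F i) g.
Proof.
exact: (big_morph (ga_mul^~ g) (fun _ _ => ga_mulDl _ _ _) (ga_mul0g _)).
Qed.

Lemma ga_mul_sumr (I : Type) (r : seq I) (F : I -> {malg K[G]}) f :
  ga_mul f (\sum_(i <- r) F i) = \sum_(i <- r) ga_mul f (F i).
Proof.
exact: (big_morph (ga_mul f) (fun _ _ => ga_mulDr _ _ _) (ga_mulg0 _)).
Qed.

Lemma ga_mulA : associative ga_mul.
Proof.
move=> f g h; rewrite [f]monalgE !ga_mul_suml; apply/eq_bigr => k1 _.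
rewrite [g]monalgE ga_mul_suml !ga_mul_sumr ga_mul_suml.
apply/eq_bigr => k2 _; rewrite [h]monalgE !ga_mul_sumr.
by apply/eq_bigr => k3 _; rewrite !ga_mulUU mulrA mulgA.
Qed.

Lemma ga_mul1g : left_id ga_one ga_mul.
Proof.
move=> g; rewrite [g]monalgE ga_mul_sumr; apply/eq_bigr => k _.
by rewrite ga_mulUU mul1r mul1g.
Qed.

Lemma ga_mulg1 : right_id ga_one ga_mul.
Proof.
move=> g; rewrite [g]monalgE ga_mul_suml; apply/eq_bigr => k _.
by rewrite ga_mulUU mulr1 mulg1.
Qed.

Lemma ga_one_neq0 : ga_one != 0.
Proof. by rewrite monalgU_eq0 oner_eq0. Qed.

HB.instance Definition _ := GRing.Zmodule_isNzRing.Build A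
  ga_mulA ga_mul1g ga_mulg1 ga_mulDl ga_mulDr ga_one_neq0.

Lemma ga_scaleE c f : c *: f = ga_mul << c *g 1%g >> f.
Proof.
rewrite [f]monalgE ga_mul_sumr scaler_sumr; apply/eq_bigr => k _.
rewrite ga_mulUU mul1g; apply/malgP => k'.
by rewrite mcoeffZ !mcoeffU mulrnAr.
Qed.

Lemma ga_scaleC c f : c *: f = ga_mul f << c *g 1%g >>.
Proof.
rewrite [f]monalgE ga_mul_suml scaler_sumr; apply/eq_bigr => k _.
rewrite ga_mulUU mulg1; apply/malgP => k'.
by rewrite mcoeffZ !mcoeffU mulrnAr mulrC.
Qed.

Lemma ga_scaleAl c (f g : A) : c *: (f * g) = (c *: f) * g.
Proof. by rewrite [LHS]ga_scaleE [in RHS](ga_scaleE c f) [LHS]ga_mulA. Qed.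

HB.instance Definition _ := GRing.Lmodule_isLalgebra.Build K A ga_scaleAl.

Lemma ga_scaleAr c (f g : A) : c *: (f * g) = f * (c *: g).
Proof. by rewrite [LHS]ga_scaleC [in RHS](ga_scaleC c g) -[LHS]ga_mulA. Qed.

HB.instance Definition _ := GRing.Lalgebra_isAlgebra.Build K A ga_scaleAr.

End GroupAlgebra.

Section RightModules.
Variable R : nzRingType.
Local Open Scope classical_set_scope.

Definition right_ideal (I : set R) : Prop :=
  [/\ I 0, (forall x y, I x -> I y -> I (x + y))
    & (forall x a, I x -> I (x * a))].

Definition right_ideal_gen (X : set R) : set R := smallest right_ideal X.

Definition right_free (B : set R) : Prop :=
  forall (s : seq R) (c : R -> R), uniq s -> (forall b, b \in s -> B b) ->
  \sum_(b <- s) b * c b = 0 -> forall b, b \in s -> c b = 0.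

Definition right_basis (B I : set R) : Prop :=
  right_ideal_gen B = I /\ right_free B.

End RightModules.

Section Exposure.
Variables (K : fieldType) (S : finType).
Local Notation F := (free_group S).
Local Notation A := (group_algebra F K).
Local Open Scope classical_set_scope.

Definition fprefix (u v : F) : bool := prefix (fword u) (fword v).

Definition supported_on (T : set F) (f : A) : Prop :=
  forall w, w \in msupp f -> T w.

Definition group_elt (w : F) : A := << 1 *g w >>.

Definition Sp (T : set F) : set A :=
  [set f | exists (s : seq F) (c : F -> K),
     (forall w, w \in s -> T w) /\ f = \sum_(w <- s) c w *: group_elt w].

Definition Schreier_transversal (I : set A) (T : set F) : Prop :=
  [/\ (forall u v, fprefix u v -> T v -> T u),
      Sp T `&` I = [set 0]
    & (forall a, exists x, I x /\ Sp T (a + x))].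

Variable le : rel F.

Definition exposure_order : Prop :=
  well_order le /\ forall u v, fprefix u v -> le u v.

Definition lt_min (X Y : set F) : Prop :=
  exists w, [/\ X w, ~ Y w & forall v, (X `+` Y) v -> le w v].

Definition lt_max (X Y : {fset F}) : Prop :=
  exists w, [/\ w \notin X, w \in Y &
    forall v, v \in ((X `\` Y) `|` (Y `\` X))%fset -> le v w].

Definition head_term (f : A) (w : F) : Prop :=
  w \in msupp f /\ forall v, v \in msupp f -> le v w.

Definition monic (f : A) : Prop := exists w, head_term f w /\ f@_w = 1.

Definition min_Schreier_transversal (I : set A) : set F :=
  get [set T | Schreier_transversal I T /\
    forall T', Schreier_transversal I T' -> T' <> T -> lt_min T T'].

Definition exposed (I : set A) (T : set F) (f : A) : Prop :=
  let candidate g := [/\ I g, monic g & supported_on T g] in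
  candidate f /\
  forall g, candidate g -> msupp g <> msupp f -> lt_max (msupp f) (msupp g).

(* Ordinals are represented by well-ordered types [W]: the initial segment of  *)
(* the recursion indexed by [W] has not stopped at any stage and produced [f]. *)
Definition exposure_process (I : set A) (W : Type) (leW : rel W) (f : W -> A) :
    Prop :=
  forall a : W,
    let Ia := right_ideal_gen [set f b | b in [set b | leW b a /\ b <> a]] in
    Ia <> I /\ exposed I (min_Schreier_transversal Ia) (f a).

(* The elements [f_alpha], [alpha < omega_I]: those reached by some initial    *)
(* segment of the process.                                                     *)
Definition exposure_basis (I : set A) : set A :=
  [set x | exists (W : Type) (leW : rel W) (f : W -> A),
    [/\ well_order leW, exposure_process I leW f & range f x]].

End Exposure.

(* Main.v *)
(* Let [T] be the greedy Schreier transversal of [I]: a word [w] enters [T] when *)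
(* its proper prefixes are in [T] and [w] is not congruent modulo [I] to an      *)
(* element supported on the smaller words of [T].  Each word [w] of the outer    *)
(* boundary of [T] is the head term of a unique [g_w] in [I] whose other terms   *)
(* are in [T].  The exposure basis is the set of the [g_w] that are not in the   *)
(* right ideal [J_w] generated by the [g_v] with [v] before [w]: below the head  *)
(* term of the exposed element, the transversals of [I] and of the ideal         *)
(* generated so far agree.                                                       *)
(*   Freeness amounts to: [g_w c] in [J_w] implies [c = 0].  Write [w = p a] with *)
(* [a] a letter.  Since [g_w] is not in [J_w], the word [p] is not in the span   *)
(* of [I] and of the words [x] such that the edge from [x] to [x a] touches [T]  *)
(* and is in [T] or exposed before [w].  A linear form on [K[F]] that vanishes   *)
(* on this span and takes the value 1 at [p] defines a twisted derivation,       *)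
(* whose restriction to [I] is a morphism of right modules that kills [J_w] and  *)
(* maps [g_w] to 1.                                                              *)
From HB Require Import structures.
Require Import Defs.
From mathcomp Require Import all_boot all_algebra.
From mathcomp Require Import boolp classical_sets wochoice.
From mathcomp Require Import finmap monalg.

Set Implicit Arguments.
Unset Strict Implicit.
Unset Printing Implicit Defensive.

Import GRing.Theory.
Local Open Scope ring_scope.
Local Open Scope classical_set_scope.

(** Write [T] for the greedy transversal of [I]; [min_Schreier_transversalE] identifies it with the
    minimal one. Every exposed element is a [g_w] outside [J_w] ([exposed_basis_elt]), and running
    the process along the head words exposes all of these ([sub_exposure_basis]). They generate [I]:
    a [g_w] inside [J_w] is redundant by induction on [w], and modulo all the [g_w] every element
    reduces to one supported on [T], which is 0 if it lies in [I] ([basis_elt_generates]). They are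
    free: in a nontrivial relation the term [g_w c] with the largest head [w] lies in [J_w], so it
    is enough that this forces [c = 0] ([last_letter_free]). Let [lam] vanish on [I] and on the
    early edges, with [lam p = 1] ([last_parent_free], [separating_functional]), and let
    [phi v = D(v) 1]. Then [phi (f v) = phi f * v + D(v) f], where [D(v) f = 0] for [f] in [I]
    because [lam] kills the right ideal [I]. So [phi] is a module morphism on [I]; it kills [J_w]
    and sends [g_w c] to [c]. *)

(** * Linear forms separating a point from a subspace *)

Lemma separating_functional (K : fieldType) (V : lmodType K) (U : set V)
    (p : V) :
  U 0 -> (forall x y, U x -> U y -> U (x + y)) ->
  (forall c x, U x -> U (c *: x)) -> ~ U p ->
  exists lam : {linear V -> K^o}, (forall x, U x -> lam x = 0) /\ lam p = 1.
Proof.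
move=> U0 UD UZ Up.
pose sub (X : set V) := [/\ forall x y, X x -> X y -> X (x + y),
  forall c x, X x -> X (c *: x) & ~ X p].
(* The condition bears on the union of [U] and [X], so that the empty chain has a valid upper
   bound. *)
have [|X [[XD XZ Xp] Xmax]] :=
    @Zorn_bigcup V [set X | sub (U `|` X)].
  move=> C sC totC.
  have pairC x y : (U `|` \bigcup_(X in C) X) x ->
      (U `|` \bigcup_(X in C) X) y -> (U x /\ U y) \/
      exists X, [/\ C X, (U `|` X) x & (U `|` X) y].
    case=> [Ux|[X CX Xx]] [Uy|[Y CY Yy]]; [by left| | |]; right.
    - by exists Y; split => //; [left|right].
    - by exists X; split => //; [right|left].
    - case: (totC _ _ CX CY) => [XY|YX].
        by exists Y; split; [|right; apply: XY|right].
      by exists X; split; [|right|right; apply: YX].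
  split=> [x y Cx Cy|c x Cx|].
  - have [[Ux Uy]|[X [CX Xx Xy]]] := pairC _ _ Cx Cy; first by left; apply: UD.
    have [XD _ _] := sC _ CX.
    by case: (XD _ _ Xx Xy) => [?|?]; [left|right; exists X].
  - have [[Ux _]|[X [CX Xx _]]] := pairC _ _ Cx Cx; first by left; apply: UZ.
    have [_ XZ _] := sC _ CX.
    by case: (XZ c _ Xx) => [?|?]; [left|right; exists X].
  - case=> [//|[X CX Xp]]; have [_ _] := sC _ CX; apply; by right.
set W := U `|` X in XD XZ Xp.
have W0 : W 0 by left.
have WN x : W x -> W (- x) by rewrite -scaleN1r; apply: XZ.
(* By maximality [W] and [p] span [V]; the form reads off the coefficient of [p], which is unique
   since [p] is outside [W]. *)
have spl x : exists c, W (x - c *: p).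
  apply: contrapT => nx.
  pose Y := [set z | exists c y, W y /\ z = y + c *: x].
  have WY : W `<=` Y by move=> z Wz; exists 0, z; rewrite scale0r addr0.
  have UY : U `|` Y = Y.
    by apply/seteqP; split=> [z [Uz|//]|z]; [apply: WY; left|right].
  apply: (Xmax Y).
    split=> [z Xz|YX]; first by apply: WY; right.
    apply: nx; exists 0; rewrite scale0r subr0; right; apply: YX.
    by exists 1, 0; rewrite scale1r add0r.
  rewrite /= UY; split=> [_ _ [c [y [Wy ->]]] [c' [y' [Wy' ->]]]
    |k _ [c [y [Wy ->]]]|[c [y [Wy Ep]]]].
  - exists (c + c'), (y + y'); rewrite scalerDl addrACA; split=> //.
    exact: XD.
  - by exists (k * c), (k *: y); rewrite scalerDr scalerA; split => //; apply: XZ.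
  - have c0 : c != 0.
      by apply: contra_not_neq Xp => c0; rewrite Ep c0 scale0r addr0.
    apply: nx; exists c^-1; rewrite Ep scalerDr scalerA mulVf // scale1r.
    by rewrite opprD addrCA subrr addr0; apply/WN/XZ.
pose l x : K := xget 0 [set c | W (x - c *: p)].
have lP x : W (x - l x *: p) by exact: (xgetPex 0 (spl x)).
have lU x c : W (x - c *: p) -> l x = c.
  move=> Wc; apply/eqP; rewrite -subr_eq0; apply: contra_notT Xp => ne.
  have := XZ (l x - c)^-1 _ (XD _ _ Wc (WN _ (lP x))).
  have -> : x - c *: p - (x - l x *: p) = (l x - c) *: p.
    by rewrite opprB addrC addrA subrK scalerBl.
  by rewrite scalerA mulVf // scale1r.
have lin : linear (l : V -> K^o).
  move=> k x y; apply: lU; rewrite scalerDl opprD addrACA -scalerA -scalerBr.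
  by apply: XD => //; apply: XZ.
pose L := GRing.isLinear.Build _ _ _ _ (l : V -> K^o) lin.
pose lam : {linear V -> K^o} := HB.pack (l : V -> K^o) L.
exists lam; split=> [x Ux|]; apply: lU; first by rewrite scale0r subr0; left.
by rewrite scale1r subrr.
Qed.

(** * Right ideals *)

Section RightIdeals.
Variables (R : nzRingType).
Implicit Types (I X : set R) (x y : R).

Lemma right_idealN I x : right_ideal I -> I x -> I (- x).
Proof. by case=> _ _ IM Ix; rewrite -mulrN1; apply: IM. Qed.

Lemma right_idealB I x y : right_ideal I -> I x -> I y -> I (x - y).
Proof.
by move=> hI Ix Iy; have [_ ID _] := hI; apply: ID => //; apply: right_idealN.
Qed.

Lemma right_ideal_genP X : right_ideal (right_ideal_gen X).
Proof.
split=> [J [[]] //|x y Xx Xy J JX|x a Xx J JX].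
  by have [[_ JD _] _] := JX; apply: JD; [apply: Xx|apply: Xy].
by have [[_ _ JM] _] := JX; apply: JM; apply: Xx.
Qed.

Lemma right_ideal_gen_sub X I : right_ideal I -> X `<=` I ->
  right_ideal_gen X `<=` I.
Proof. exact: smallest_sub. Qed.

Lemma sub_right_ideal_gen X : X `<=` right_ideal_gen X.
Proof. exact: sub_gen_smallest. Qed.

End RightIdeals.

(** * Coefficients and supports in the group algebra *)

Section Support.
Variables (K : fieldType) (S : finType).
Local Notation F := (free_group S).
Local Notation A := (group_algebra F K).
Local Notation "[ w ]" := (group_elt K w : A) (at level 0, w at level 200).
Implicit Types (I : set A) (T : set F) (f g : A) (u v w : F).

Lemma group_eltM u v : [(u * v)%g] = [u] * [v].
Proof. by rewrite [RHS]ga_mulUU mulr1. Qed.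

Lemma group_elt1 : [1%g] = 1.
Proof. by []. Qed.

Lemma mcoeff_elt u v : (group_elt K u)@_v = (u == v)%:R.
Proof. exact: mcoeffU. Qed.

Lemma mcoeffZA c f w : (c *: f : A)@_w = c * f@_w.
Proof. exact: mcoeffZ. Qed.

Lemma mcoeffDA f g w : (f + g : A)@_w = f@_w + g@_w.
Proof. exact: mcoeffD. Qed.

Lemma mcoeffBA f g w : (f - g : A)@_w = f@_w - g@_w.
Proof. exact: mcoeffB. Qed.

Lemma group_algebraE f : f = \sum_(w <- msupp f) f@_w *: [w].
Proof.
rewrite [LHS]monalgE; apply: eq_bigr => w _.
by apply/malgP => v; rewrite mcoeffZA mcoeff_elt mcoeffU mulr_natr.
Qed.

Lemma group_algebra_ind (P : A -> Prop) :
  P 0 -> (forall f g, P f -> P g -> P (f + g)) ->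
  (forall c w, P (c *: [w])) -> forall f, P f.
Proof. by move=> P0 PD PU f; rewrite [f]group_algebraE; apply: big_ind. Qed.

Lemma right_idealZ I c f : right_ideal I -> I f -> I (c *: f).
Proof.
by case=> _ _ IM If; rewrite -[f]mulr1 scalerAr; apply: IM.
Qed.

Lemma supportedP T f : supported_on T f <-> forall w, f@_w != 0 -> T w.
Proof. by split=> h w; [rewrite mcoeff_neq0|rewrite -mcoeff_neq0]; apply: h. Qed.

Lemma supported0 T : supported_on T (0 : A).
Proof. by move=> w; rewrite msupp0. Qed.

Lemma supportedD T f g :
  supported_on T f -> supported_on T g -> supported_on T (f + g).
Proof.
move=> /supportedP Tf /supportedP Tg; apply/supportedP => w; rewrite mcoeffDA.
by have [->|/Tf//] := eqVneq f@_w 0; rewrite add0r => /Tg.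
Qed.

Lemma supportedZ T c f : supported_on T f -> supported_on T (c *: f).
Proof.
move=> /supportedP Tf; apply/supportedP => w; rewrite mcoeffZA mulf_eq0.
by case/norP => _ /Tf.
Qed.

Lemma supportedN T f : supported_on T f -> supported_on T (- f).
Proof. by rewrite -scaleN1r; apply: supportedZ. Qed.

Lemma supportedB T f g :
  supported_on T f -> supported_on T g -> supported_on T (f - g).
Proof. by move=> Tf Tg; apply: supportedD => //; apply: supportedN. Qed.

Lemma supported_elt T w : T w -> supported_on T [w].
Proof.
move=> Tw; apply/supportedP => v; rewrite mcoeff_elt.
by have [<- //|_] := eqVneq w v; rewrite eqxx.
Qed.

Lemma supported_sub T T' f : T `<=` T' -> supported_on T f -> supported_on T' f.
Proof. by move=> sT Tf w /Tf/sT. Qed.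

Lemma supported_sum (X : eqType) T (s : seq X) (f : X -> A) :
  (forall x, x \in s -> supported_on T (f x)) ->
  supported_on T (\sum_(x <- s) f x).
Proof.
move=> Tf; rewrite big_seq; apply: big_ind => //; first exact: supported0.
exact: supportedD.
Qed.

Lemma SpP T f : Sp T f <-> supported_on T f.
Proof.
split=> [[s [c [Ts ->]]]|Tf].
  apply: supported_sum => w /Ts Tw; apply: supportedZ.
  exact: supported_elt.
by exists (msupp f), (fun w => f@_w); split; [exact: Tf|exact: group_algebraE].
Qed.

End Support.

(** * Reduced words, prefixes and the Cayley graph *)

Section Words.
Variable S : finType.
Local Notation F := (free_group S).
Implicit Types (p u v w : F) (a b : letter S) (T : set F).
Local Open Scope group_scope.

Definition gen b : F := @FreeWord S [:: b] isT.

Lemma gen_linv b : gen (linv b) = (gen b)^-1.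
Proof.
apply: (can_inj (mulKg (gen b))); rewrite mulgV.
by apply: val_inj; rewrite /= eqxx.
Qed.

Lemma linv_neq b : (b == linv b) = false.
Proof. by case: b => s b; rewrite /linv xpair_eqE eqxx; case: b. Qed.

Lemma reduced_cat (s t : seq (letter S)) : reduced (s ++ t) -> reduced s.
Proof. by case: s => //= a s; rewrite /reduced /= cat_path => /andP[]. Qed.

Lemma wmul_cat (s t : seq (letter S)) : reduced (s ++ t) -> wmul s t = s ++ t.
Proof.
elim: s => //= a s IHs rst; rewrite IHs ?(reduced_behead rst) //.
by case: (s ++ t) rst => //= b r /andP[/negbTE ->].
Qed.

(** Only the last letter of [u] can cancel with [b]; so in the Cayley graph one end of each edge is
    the parent prefix of the other. *)
Lemma fword_mul_gen u b :
  fword (u * gen b) = rcons (fword u) b \/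
  fword u = rcons (fword (u * gen b)) (linv b).
Proof.
have -> : fword (u * gen b) = wmul (fword u) [:: b] by [].
have := fwordP u; case/lastP: (fword u) => [|s c] rsc; first by left.
have rs : reduced s by apply: (@reduced_cat s [:: c]); rewrite cats1.
have -> : wmul (rcons s c) [:: b] = wmul s (push c [:: b]).
  by rewrite /wmul foldr_rcons.
rewrite /=; case: eqP => [->|/eqP cb]; first by right; rewrite wmul1 // linvK.
left; rewrite wmul_cat -cat_rcons ?cats1 //.
case: s rsc {rs} => [|d s]; rewrite /reduced /= ?cb // => rsc.
by rewrite rcons_path last_rcons cb rsc.
Qed.

Lemma mul_gen_linv u b : u * gen b * gen (linv b) = u.
Proof. by rewrite gen_linv mulgK. Qed.

Lemma fword_last v : v = 1 \/
  exists p a, v = p * gen a /\ fword v = rcons (fword p) a.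
Proof.
case: v => s; case/lastP: s => [|s a] rsa; [left; exact: val_inj|right].
have rs : reduced s by apply: (@reduced_cat s [:: a]); rewrite cats1.
exists (FreeWord rs), a; split=> //; apply: val_inj.
by rewrite /= wmul_cat cats1.
Qed.

Lemma word_ind (P : F -> Prop) : P 1 ->
  (forall p a, fword (p * gen a) = rcons (fword p) a -> P p ->
     P (p * gen a)) ->
  forall w, P w.
Proof.
move=> P1 PS w; have [n] := ubnP (size (fword w)); elim: n w => // n IHn w.
have [-> //|[p [a [-> Ew]]]] := fword_last w.
rewrite Ew size_rcons ltnS => le_n; exact/PS/IHn.
Qed.

Lemma fprefix_rcons u p v a : fword v = rcons (fword p) a ->
  fprefix u v -> u = v \/ fprefix u p.
Proof.
move=> Ev /prefixP[s]; case/lastP: s => [|s b].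
  by rewrite cats0 => /val_inj ->; left.
rewrite Ev -rcons_cat => /rcons_inj[Ep _]; right; apply/prefixP; by exists s.
Qed.

Lemma fprefix_parent p v a : fword v = rcons (fword p) a ->
  fprefix p v /\ p <> v.
Proof.
move=> Ev; split=> [|pv]; first by rewrite /fprefix Ev prefix_rcons.
by have := congr1 size Ev; rewrite pv size_rcons => /n_Sn.
Qed.

Definition prefix_closed T := forall u v, fprefix u v -> T v -> T u.

(* The words of [T] together with its outer boundary, if [T] is prefix-closed. *)
Definition reachable T v := forall u, fprefix u v -> u <> v -> T u.

Lemma reachable1 T : reachable T 1.
Proof.
by move=> u; rewrite /fprefix prefixs0 => /eqP u1 []; apply: val_inj.
Qed.

Lemma prefix_closed_reachable T v : prefix_closed T -> T v -> reachable T v.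
Proof. by move=> cT Tv u uv _; apply: cT uv Tv. Qed.

Lemma reachable_rcons T p v a : prefix_closed T -> T p ->
  fword v = rcons (fword p) a -> reachable T v.
Proof. by move=> cT Tp Ev u /(fprefix_rcons Ev)[//|up] _; apply: cT up Tp. Qed.

Lemma reachable_mul_gen T t b : prefix_closed T -> T t ->
  reachable T (t * gen b).
Proof.
move=> cT Tt; have [Ev|Et] := fword_mul_gen t b.
  exact: reachable_rcons Ev.
apply: prefix_closed_reachable => //; apply: cT Tt.
by have [] := fprefix_parent Et.
Qed.

Lemma reachable_parent T p v a : fword v = rcons (fword p) a ->
  reachable T v -> T p.
Proof. by move=> /fprefix_parent[pv ne] /(_ _ pv ne). Qed.

End Words.

(** * Twisted derivations *)

(* The twisted derivation [D] with [D(u v) x = D(u) x * v + D(v)(x * u)] that    *)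
(* takes the values [D(a) x = lam x] and [D(b) x = 0] for [b] a letter other    *)
(* than [a] and its inverse.                                                    *)
Section TwistedDerivation.
Variables (K : fieldType) (S : finType) (R : algType K).
Variable E : free_group S -> R.
Hypotheses (E1 : E 1%g = 1) (EM : forall u v, E (u * v)%g = E u * E v).
Variables (a : letter S) (lam : {linear R -> K^o}).
Implicit Types (x y : R) (u v w : free_group S) (b : letter S).
Implicit Types (s t : seq (letter S)).

(** The value at the inverse of [a] is forced by the product rule applied to [a] times its
    inverse. *)
Definition letter_deriv b x : R :=
  if b == a then (lam x : K) *: (1 : R)
  else if b == linv a then - ((lam (x * E (gen b)) : K) *: E (gen b)) else 0.

Definition word_eval s : R := foldr (fun b f => E (gen b) * f) 1 s.

(** Each factorization [s = u a v] contributes [lam (x u) v], and each [s = u a^-1 v] contributes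
    [- lam (x u a^-1) a^-1 v]: a signed sum over the [a]-edges on the path spelled by [s]. *)
Fixpoint seq_deriv s x : R :=
  if s is b :: s' then
    letter_deriv b x * word_eval s' + seq_deriv s' (x * E (gen b))
  else 0.

Lemma E_genK b : E (gen b) * E (gen (linv b)) = 1.
Proof. by rewrite -EM gen_linv mulgV E1. Qed.

Lemma mulr_genK x b : x * E (gen b) * E (gen (linv b)) = x.
Proof. by rewrite -mulrA E_genK mulr1. Qed.

(** Cancelling pairs contribute nothing, which makes the derivation compatible with reduction of
    words. *)
Lemma letter_deriv_linv b x :
  letter_deriv b x * E (gen (linv b)) +
    letter_deriv (linv b) (x * E (gen b)) = 0.
Proof.
rewrite /letter_deriv; case: (b =P a) => [->|/eqP ba].
  rewrite eq_sym linv_neq eqxx mulr_genK -scalerAl mul1r; exact: subrr.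
rewrite (can2_eq (@linvK S) (@linvK S)); case: eqP => [->|_].
  rewrite linvK mulNr -scalerAl.
  have -> : E (gen (linv a)) * E (gen a) = 1 by rewrite -{2}[a]linvK E_genK.
  exact: addNr.
by rewrite (can_eq (@linvK S)) (negbTE ba) mul0r addr0.
Qed.

Lemma seq_deriv_push b s x : seq_deriv (push b s) x = seq_deriv (b :: s) x.
Proof.
case: s => [//|c s] /=; case: eqP => [->|//].
by rewrite mulr_genK mulrA addrA -mulrDl letter_deriv_linv mul0r add0r.
Qed.

Lemma word_eval_push b s : word_eval (push b s) = E (gen b) * word_eval s.
Proof.
by case: s => [//|c s] /=; case: eqP => [->|//]; rewrite mulrA E_genK mul1r.
Qed.

Lemma word_eval_wmul s t : word_eval (wmul s t) = word_eval s * word_eval t.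
Proof.
by elim: s => [|b s IHs] /=; rewrite ?mul1r // word_eval_push IHs mulrA.
Qed.

Lemma word_evalE w : word_eval (fword w) = E w.
Proof.
elim/word_ind: w => [|p b _ IHp]; first by rewrite E1.
by rewrite [fword _]/(wmul (fword p) [:: b]) word_eval_wmul IHp EM /= mulr1.
Qed.

Lemma seq_deriv_wmul s t x :
  seq_deriv (wmul s t) x =
  seq_deriv s x * word_eval t + seq_deriv t (x * word_eval s).
Proof.
elim: s x => [|b s IHs] x /=; first by rewrite mul0r add0r mulr1.
rewrite seq_deriv_push /= IHs word_eval_wmul mulrDl !mulrA addrA.
by [].
Qed.

Lemma seq_deriv_linear s c x y :
  seq_deriv s (c *: x + y) = c *: seq_deriv s x + seq_deriv s y.
Proof.
elim: s x y => [|b s IHs] x y /=; first by rewrite scaler0 addr0.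
have -> : letter_deriv b (c *: x + y) = c *: letter_deriv b x + letter_deriv b y.
  rewrite /letter_deriv; case: ifP => _.
    by rewrite linearP scalerDl -scalerA.
  case: ifP => _; last by rewrite scaler0 addr0.
  by rewrite mulrDl -scalerAl linearP scalerDl opprD -scalerA scalerN.
rewrite !mulrDl -!scalerAl IHs scalerDr addrACA; congr (_ + _).
Qed.

Definition tderiv w x : R := seq_deriv (fword w) x.

Lemma tderiv_mul u v x :
  tderiv (u * v)%g x = tderiv u x * E v + tderiv v (x * E u).
Proof. by rewrite /tderiv seq_deriv_wmul !word_evalE. Qed.

Lemma tderiv_gen b x : tderiv (gen b) x = letter_deriv b x.
Proof. by rewrite /tderiv /= mulr1 addr0. Qed.

Lemma tderiv_linear w c x y :
  tderiv w (c *: x + y) = c *: tderiv w x + tderiv w y.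
Proof. exact: seq_deriv_linear. Qed.

Lemma tderiv0 w : tderiv w 0 = 0.
Proof. by have := tderiv_linear w (-1) 0 0; rewrite !scaleN1r !addNr. Qed.

Lemma tderivD w x y : tderiv w (x + y) = tderiv w x + tderiv w y.
Proof. by have := tderiv_linear w 1 x y; rewrite !scale1r. Qed.

Lemma tderivZ w c x : tderiv w (c *: x) = c *: tderiv w x.
Proof. by have := tderiv_linear w c x 0; rewrite tderiv0 !addr0. Qed.

Hypothesis E_ind : forall P : R -> Prop, P 0 ->
  (forall f g, P f -> P g -> P (f + g)) -> (forall c w, P (c *: E w)) ->
  forall f, P f.

Lemma twisted_derivation_morph (phi : {linear R -> R}) f g :
  (forall w, phi (E w) = tderiv w 1) -> (forall w, tderiv w f = 0) ->
  phi (f * g) = phi f * g.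
Proof.
move=> phiE Df; have phi_mulE h w : phi (h * E w) = phi h * E w + tderiv w h.
  elim/E_ind: h => [|h k IHh IHk|c v].
  - by rewrite mul0r linear0 mul0r add0r tderiv0.
  - by rewrite mulrDl !linearD IHh IHk mulrDl addrACA tderivD.
  - rewrite -scalerAl -EM !linearZ /= !phiE tderivZ -scalerAl -scalerDr.
    by rewrite tderiv_mul mul1r.
elim/E_ind: g => [|g h IHg IHh|c w].
- by rewrite !mulr0 linear0.
- by rewrite !mulrDr linearD IHg IHh.
- by rewrite -!scalerAr linearZ /= phi_mulE Df addr0.
Qed.

End TwistedDerivation.

Lemma group_algebra_extension (K : fieldType) (S : finType)
    (V : lmodType K) (g : free_group S -> V) :
  exists phi : {linear group_algebra (free_group S) K -> V},
    forall w, phi (group_elt K w) = g w.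
Proof.
pose A := group_algebra (free_group S) K.
pose l (f : A) : V := \sum_(w <- msupp f) f@_w *: g w.
have l_sub (d : {fset free_group S}) f : (msupp f `<=` d)%fset ->
    l f = \sum_(w <- d) f@_w *: g w.
  move=> sub; rewrite /l (big_fset_incl _ sub) // => w _.
  by move/mcoeff_outdom => ->; rewrite scale0r.
have lin : linear l.
  move=> c x y; pose d := (msupp x `|` msupp y)%fset.
  have sx : (msupp x `<=` d)%fset by apply: fsubsetUl.
  have sy : (msupp y `<=` d)%fset by apply: fsubsetUr.
  have sxy : (msupp (c *: x + y) `<=` d)%fset.
    apply: fsubset_trans (msuppD_le _ _) _; rewrite fsubUset sy andbT.
    exact: fsubset_trans (msuppZ_le _ _) sx.
  rewrite (l_sub _ _ sx) (l_sub _ _ sy) (l_sub _ _ sxy).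
  rewrite scaler_sumr -big_split; apply: eq_bigr => w _ /=.
  by rewrite mcoeffDA mcoeffZA scalerDl scalerA.
pose L := GRing.isLinear.Build _ _ _ _ l lin.
pose phi : {linear A -> V} := HB.pack l L.
exists phi => w; rewrite -[LHS]/(l _) (l_sub _ _ msuppU_le) big_seq_fset1.
by rewrite mcoeff_elt eqxx scale1r.
Qed.

(** * Well-orders *)

Section WellOrder.
Variables (T : eqType) (R : rel T).
Hypothesis wo : well_order R.

Let wo_chain_all : wo_chain R predT := withinW wo.

Lemma wo_total : total R.
Proof. by move=> x y; apply: (wo_chainW wo_chain_all). Qed.

Lemma wo_refl : reflexive R.
Proof. by move=> x; apply: (wo_chain_reflexive wo_chain_all). Qed.

Lemma wo_anti : antisymmetric R.
Proof. by move=> x y; apply: (wo_chain_antisymmetric wo_chain_all). Qed.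

Lemma wo_min (P : set T) x : P x -> exists y, P y /\ forall z, P z -> R y z.
Proof.
move=> Px; have [|y [[/asboolP Py ymin] _]] := wo (A := fun z => `[< P z >]).
  by exists x; apply/asboolP.
by exists y; split=> // z Pz; apply/ymin/asboolP.
Qed.

(** A well-order is given by unique minima of nonempty sets; here the minimum of [{x, y, z}]
    decides. *)
Lemma wo_trans : transitive R.
Proof.
move=> y x z Rxy Ryz.
have [m [mP mmin]] :=
  @wo_min (fun t => [\/ t = x, t = y | t = z]) x (Or31 _ _ erefl).
case: mP mmin => -> mmin.
- by apply: mmin; apply: Or33.
- suff -> : x = y by [].
  by apply/wo_anti; rewrite Rxy; apply: mmin; apply: Or31.
- suff <- : y = z by [].
  by apply/wo_anti; rewrite Ryz; apply: mmin; apply: Or32.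
Qed.

Definition strict x y := R x y && (x != y).

Lemma strict_ind (P : T -> Prop) :
  (forall x, (forall y, strict y x -> P y) -> P x) -> forall x, P x.
Proof.
move=> IH x; apply: contrapT => nPx.
have [m [nPm mmin]] := @wo_min (fun y => ~ P y) x nPx.
apply/nPm/IH => y /andP[Rym /eqP ym]; apply: contrapT => /mmin Rmy.
by apply: ym; apply: wo_anti; rewrite Rym.
Qed.

Lemma strict_wf : well_founded (fun x y => strict x y).
Proof. by elim/strict_ind => x IH; constructor. Qed.

Lemma strict_total x y : [\/ strict x y, x = y | strict y x].
Proof.
rewrite /strict [y == x]eq_sym; have [->|xy] := eqVneq x y.
  exact: Or32.
by case/orP: (wo_total x y) => Rxy; [apply: Or31|apply: Or33]; rewrite Rxy.
Qed.

Lemma strictNle x y : strict x y -> ~ R y x.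
Proof.
by move=> /andP[Rxy /eqP xy] Ryx; apply: xy; apply: wo_anti; rewrite Rxy.
Qed.

Lemma strict_irr x : ~ strict x x.
Proof. by rewrite /strict eqxx andbF. Qed.

Lemma le_strict_trans y x z : R x y -> strict y z -> strict x z.
Proof.
move=> Rxy /[dup] yz /andP[Ryz _]; rewrite /strict (wo_trans Rxy Ryz).
by apply: contra_not_neq (strictNle yz) => <-.
Qed.

Lemma wo_max_seq (s : seq T) x : x \in s ->
  exists m, m \in s /\ forall v, v \in s -> R v m.
Proof.
elim: s x => // y s IHs x _; have [->|[z zs]] : s = [::] \/ exists z, z \in s.
- by case: s {IHs} => [|z s]; [left|right; exists z; apply: mem_head].
- by exists y; rewrite mem_head; split=> // v /[!inE] /eqP ->; apply: wo_refl.
have [m [ms mmax]] := IHs z zs; case/orP: (wo_total y m) => ym.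
  exists m; rewrite inE ms orbT; split=> // v.
  by rewrite inE => /predU1P[->|/mmax].
exists y; rewrite mem_head; split=> // v; rewrite inE => /predU1P[->|/mmax vm].
  exact: wo_refl.
exact: wo_trans vm ym.
Qed.

Lemma strict_trans y x z : strict x y -> strict y z -> strict x z.
Proof. by case/andP => Rxy _; apply: le_strict_trans. Qed.

End WellOrder.

(** * The greedy transversal is the minimal Schreier transversal *)

Section Transversal.
Variables (K : fieldType) (S : finType).
Local Notation F := (free_group S).
Local Notation A := (group_algebra F K).
Local Notation E := (@group_elt K S).
Variable le : rel F.
Hypothesis hle : exposure_order le.
Local Notation lt := (strict le).
Implicit Types (I J U : set A) (T : set F) (f g h y : A) (u v w : F).

Lemma exposure_wo : well_order le. Proof. by case: hle. Qed.
Local Hint Resolve exposure_wo : core.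

Lemma fprefix_lt u v : fprefix u v -> u <> v -> lt u v.
Proof. by move=> uv /eqP ne; rewrite /strict ne (proj2 hle). Qed.

Definition below T w : set F := [set v | T v /\ lt v w].

Definition reducible I T w :=
  exists y, supported_on (below T w) y /\ I (E w - y).

Lemma below_sub T w : below T w `<=` T. Proof. by move=> v []. Qed.

Lemma below_agree T T' w : (forall v, lt v w -> (T v <-> T' v)) ->
  below T w = below T' w.
Proof.
by move=> TT'; apply/seteqP; split=> v [Tv vw]; split=> //; apply/(TT' _ vw).
Qed.

Lemma reachable_agree T T' w : (forall v, lt v w -> (T v <-> T' v)) ->
  reachable T w -> reachable T' w.
Proof.
by move=> TT' Tw u uw ne; apply/TT'; [apply: fprefix_lt|apply: Tw].
Qed.

Lemma head_term_exists f : f <> 0 -> exists w, head_term le f w.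
Proof.
move=> f0; have [x fx] : exists x, x \in msupp f.
  apply: contrapT => nf; apply: f0; apply/malgP => w.
  rewrite mcoeff0; apply/mcoeff_outdom/negP => wf; apply: nf; by exists w.
have [m [ms mmax]] := @wo_max_seq _ _ exposure_wo (msupp f) x fx.
by exists m.
Qed.

Lemma supported_below_coef T w y : supported_on (below T w) y -> y@_w = 0.
Proof.
move=> /supportedP Ty; apply/eqP; apply/negPn/negP => /Ty[_].
exact: strict_irr.
Qed.

(** Well-founded recursion along the strict order, possible because proper prefixes are smaller.
    [greedyP] is the fixed-point equation. *)
Definition greedy I : F -> Prop :=
  Fix (strict_wf exposure_wo) (fun _ => Prop) (fun w rec =>
    (forall u (uw : lt u w), fprefix u w -> rec u uw) /\
    ~ exists y, supported_on [set v | exists vw : lt v w, rec v vw] y /\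
                I (E w - y)).

Lemma greedyP I w :
  greedy I w <-> reachable (greedy I) w /\ ~ reducible I (greedy I) w.
Proof.
rewrite {1}/greedy Fix_eq -/(greedy I); last first.
  move=> x f g fg; suff -> : f = g by [].
  apply: functional_extensionality_dep => v.
  exact: functional_extensionality_dep.
have -> : [set v | exists _ : lt v w, greedy I v] = below (greedy I) w.
  by apply/seteqP; split=> v [].
split=> -[Tw nw]; split=> // u; last first.
  by move=> uw p; apply: Tw => // uE; move: uw; rewrite uE => /strict_irr.
by move=> uw ne; apply: Tw => //; apply: fprefix_lt.
Qed.

Lemma greedy_closed I : prefix_closed (greedy I).
Proof.
move=> u v uv Tv; have [->//|/eqP ne] := eqVneq u v.
by have [Tv' _] := (greedyP I v).1 Tv; apply: Tv'.
Qed.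

Section Ideal.
Variable I : set A.
Hypothesis hI : right_ideal I.

Lemma reducible_scale T w f : f@_w != 0 -> I f ->
  (forall v, f@_v != 0 -> v <> w -> below T w v) -> reducible I T w.
Proof.
move=> fw If Tf; exists (E w - (f@_w)^-1 *: f); split.
  apply/supportedP => v; rewrite mcoeffBA mcoeffZA mcoeff_elt.
  have [<-|wv] := eqVneq w v; first by rewrite mulVf // subrr eqxx.
  rewrite sub0r oppr_eq0 mulf_eq0 => /norP[_ /Tf]; apply => vw.
  by rewrite vw eqxx in wv.
by rewrite subKr; apply: right_idealZ.
Qed.

(** Otherwise the head term of [f], after division by its coefficient, would be reducible to smaller
    greedy words. *)
Lemma greedy_independent f : supported_on (greedy I) f -> I f -> f = 0.
Proof.
move=> Tf If; apply: contrapT => /head_term_exists[w [fw wmax]].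
have /greedyP[_ []] := Tf w fw; apply: (@reducible_scale _ _ f) => //.
  by rewrite mcoeff_neq0.
move=> v; rewrite mcoeff_neq0 => fv /eqP ne; split; first exact: Tf.
by rewrite /strict ne wmax.
Qed.

(** Induction on the word: once the parent is reduced to [T], multiplication by the last letter
    sends words of [T] to reachable words, which the hypothesis reduces again. *)
Lemma span_reachable T f : prefix_closed T ->
  (forall v, reachable T v -> exists y, supported_on T y /\ I (E v - y)) ->
  exists y, supported_on T y /\ I (f - y).
Proof.
move=> cT red; have [I0 ID IM] := hI.
have spanD g h : (exists y, supported_on T y /\ I (g - y)) ->
    (exists y, supported_on T y /\ I (h - y)) ->
    exists y, supported_on T y /\ I (g + h - y).
  move=> [y [Ty Iy]] [z [Tz Iz]]; exists (y + z); split; first exact: supportedD.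
  by rewrite opprD addrACA; apply: ID.
have span0 : exists y, supported_on T y /\ I (0 - y).
  by exists 0; rewrite subr0; split=> //; apply: supported0.
have spanZ c g : (exists y, supported_on T y /\ I (g - y)) ->
    exists y, supported_on T y /\ I (c *: g - y).
  move=> [y [Ty Iy]]; exists (c *: y); split; first exact: supportedZ.
  by rewrite -scalerBr; apply: right_idealZ.
suff spanE w : exists y, supported_on T y /\ I (E w - y).
  by elim/group_algebra_ind: f => [|g h|c w]; [|exact: spanD|apply: spanZ].
elim/word_ind: w => [|p a _ [y [Ty Iy]]]; first by apply: red; apply: reachable1.
have [z [Tz Iz]] : exists z, supported_on T z /\ I (y * E (gen a) - z).
  rewrite [y]group_algebraE mulr_suml big_seq.
  apply: (big_ind (fun g => exists z, supported_on T z /\ I (g - z))) => //.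
  move=> t /Ty Tt.
  rewrite -scalerAl -group_eltM; apply: spanZ; apply: red.
  exact: reachable_mul_gen.
exists z; split=> //; rewrite group_eltM.
have -> : E p * E (gen a) - z = (E p - y) * E (gen a) + (y * E (gen a) - z).
  by rewrite mulrBl addrA subrK.
by apply: ID => //; apply: IM.
Qed.

Lemma greedy_reduce v : reachable (greedy I) v ->
  greedy I v \/ reducible I (greedy I) v.
Proof.
move=> Tv; apply: contrapT => /not_orP[nT nr]; apply: nT; exact/greedyP.
Qed.

Lemma greedy_span f : exists y, supported_on (greedy I) y /\ I (f - y).
Proof.
apply: span_reachable; first exact: greedy_closed.
move=> v /greedy_reduce[Tv|[y [Ty Iy]]].
  exists (E v); split; first exact: supported_elt.
  by rewrite subrr; case: hI.
by exists y; split=> //; apply: supported_sub Ty; apply: below_sub.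
Qed.

Lemma greedy_Schreier : Schreier_transversal I (greedy I).
Proof.
split=> [u v|| f]; first exact: greedy_closed.
  apply/seteqP; split=> [f [/SpP Tf If]|_ ->]; first exact: greedy_independent.
  by split; [apply/SpP; apply: supported0|case: hI].
have [y [Ty Iy]] := greedy_span f; exists (y - f); split.
  by rewrite -opprB; apply: right_idealN.
by rewrite addrC subrK; apply/SpP.
Qed.

(** Suppose the first difference [w] is in [T] but not greedy. Since both sets agree below [w], it
    is reducible to smaller words of [T], which gives a nonzero element of [I] supported on [T]. *)
Lemma greedy_min T : Schreier_transversal I T -> T <> greedy I ->
  lt_min le (greedy I) T.
Proof.
move=> [cT indT _] ne.
have [x Dx] : exists x, (greedy I `+` T) x.
  apply: contrapT => nD; apply: ne; apply/seteqP; split=> x Tx;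
  apply: contrapT => nT; apply: nD; exists x; [right|left]; by split.
have [w [Dw wmin]] := wo_min exposure_wo Dx.
have agree v : lt v w -> (T v <-> greedy I v).
  move=> vw; split=> Tv; apply: contrapT => nT;
  apply: (strictNle exposure_wo vw); apply: wmin; [right|left]; by split.
case: Dw => [[Tw nTw]|[Tw nTw]]; first by exists w; split.
have [] := @greedy_reduce w; last 2 first.
- by [].
- move=> [y [Ty Iy]]; rewrite -(below_agree agree) in Ty.
  have : (Sp T `&` I) (E w - y).
    split=> //; apply/SpP; apply: supportedB; first exact: supported_elt.
    by apply: supported_sub Ty; apply: below_sub.
  rewrite indT => /(congr1 (mcoeff w)).
  rewrite mcoeffBA mcoeff_elt eqxx (supported_below_coef Ty) subr0 mcoeff0.
  by move/eqP; rewrite oner_eq0.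
apply: reachable_agree agree _; apply: prefix_closed_reachable Tw; exact: cT.
Qed.

Lemma min_Schreier_transversalE : min_Schreier_transversal le I = greedy I.
Proof.
apply: get_unique => [|T [ST Tmin]].
  by split; [exact: greedy_Schreier|exact: greedy_min].
apply: contrapT => ne.
have [w [Tw nGw wmin]] := Tmin _ greedy_Schreier (nesym ne).
have [v [Gv nTv vmin]] := greedy_min ST ne.
suff E : w = v by rewrite E in Tw.
apply: (wo_anti exposure_wo); rewrite wmin ?vmin //; [right|right]; by split.
Qed.

End Ideal.

End Transversal.

(** * Boundary elements, and why exposed elements are among them *)

Section ExposureBasis.
Variables (K : fieldType) (S : finType).
Local Notation F := (free_group S).
Local Notation A := (group_algebra F K).
Local Notation E := (@group_elt K S).
Variable le : rel F.
Hypothesis hle : exposure_order le.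
Local Notation lt := (strict le).
Variable I : set A.
Hypothesis hI : right_ideal I.
Implicit Types (J : set A) (f g h x y : A) (u v w : F).
Local Notation wo := (exposure_wo hle).
Local Notation T := (greedy hle I).
Local Notation below := (below le).

(** The element [g_w]; that [w] lies outside [T] follows, by [boundary_notin]. *)
Definition boundary_elt w h :=
  [/\ reachable T w, I h & supported_on (below T w) (h - E w)].

Definition early_gens w : set A :=
  [set h | exists v, lt v w /\ boundary_elt v h].

Definition early_ideal w : set A := right_ideal_gen (early_gens w).

Definition basis_elt w h := boundary_elt w h /\ ~ early_ideal w h.

Lemma boundary_elt_supp w h v :
  boundary_elt w h -> v \in msupp h -> v = w \/ below T w v.
Proof.
move=> [_ _ /supportedP Th] hv; have [->|wv] := eqVneq w v; first by left.
right; apply: Th; rewrite mcoeffBA mcoeff_elt (negbTE wv) subr0.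
by rewrite mcoeff_neq0.
Qed.

Lemma boundary_elt_coef w h : boundary_elt w h -> h@_w = 1.
Proof.
move=> [_ _ /supported_below_coef]; rewrite mcoeffBA mcoeff_elt eqxx => /eqP.
by rewrite subr_eq0 => /eqP.
Qed.

Lemma boundary_elt_head w h : boundary_elt w h -> head_term le h w.
Proof.
move=> bh; split; first by rewrite -mcoeff_neq0 (boundary_elt_coef bh) oner_neq0.
move=> v /(boundary_elt_supp bh)[->|[_ /andP[]//]]; exact: (wo_refl wo).
Qed.

Lemma boundary_elt_uniq w h h' :
  boundary_elt w h -> boundary_elt w h' -> h = h'.
Proof.
move=> [_ Ih Th] [_ Ih' Th']; apply/eqP; rewrite -subr_eq0; apply/eqP.
apply: (@greedy_independent _ _ _ hle _ hI); last exact: right_idealB.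
have -> : h - h' = (h - E w) - (h' - E w) by rewrite opprB addrA subrK.
by apply: supportedB; [move: Th|move: Th'];
  apply: supported_sub; apply: below_sub.
Qed.

Lemma reducible_boundary w y : reachable T w -> supported_on (below T w) y ->
  I (E w - y) -> boundary_elt w (E w - y).
Proof.
by move=> Tw Ty Iy; split=> //; rewrite addrC addKr; apply: supportedN.
Qed.

Lemma boundary_reducible w h : boundary_elt w h ->
  exists y, [/\ supported_on (below T w) y, I (E w - y) & h = E w - y].
Proof.
move=> [_ Ih Th]; exists (E w - h); rewrite subKr; split => //.
by rewrite -opprB; apply: supportedN.
Qed.

Lemma boundary_notin w h : boundary_elt w h -> ~ T w.
Proof.
move=> /boundary_reducible[y [Ty Iy _]] /greedyP[_]; apply; by exists y.
Qed.

Lemma boundary_exists w : reachable T w -> ~ T w -> exists h, boundary_elt w h.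
Proof.
move=> Tw nTw; have [//|[y [Ty Iy]]] := greedy_reduce Tw.
by exists (E w - y); apply: reducible_boundary.
Qed.

Lemma early_ideal_sub_of J w : right_ideal J ->
  (forall v h, lt v w -> boundary_elt v h -> J h) -> early_ideal w `<=` J.
Proof.
by move=> hJ Jw; apply: right_ideal_gen_sub => // h [v [vw bh]]; apply: Jw bh.
Qed.

Lemma early_ideal_sub w : early_ideal w `<=` I.
Proof. by apply: early_ideal_sub_of => // v h _ []. Qed.

(** A boundary element that is not a basis element lies in the ideal of the earlier ones, so
    induction on the head applies. *)
Lemma boundary_in_span J w : right_ideal J ->
  (forall v h, lt v w -> basis_elt v h -> J h) ->
  forall v h, lt v w -> boundary_elt v h -> J h.
Proof.
move=> hJ Jw; elim/(strict_ind wo) => v IH h vw bh.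
have [Jv|nJ] := pselect (early_ideal v h); last by apply: (Jw v).
apply: (early_ideal_sub_of hJ _ Jv) => u g uv; apply: IH => //.
exact: (strict_trans wo) vw.
Qed.

(** Irreducibility modulo [I] implies irreducibility modulo the smaller [J]; only the other
    inclusion has to be assumed. *)
Lemma greedy_agree J w : right_ideal J -> J `<=` I ->
  (forall v, lt v w -> (forall u, lt u v -> (greedy hle J u <-> T u)) ->
     greedy hle J v -> T v) ->
  forall v, lt v w -> (greedy hle J v <-> T v).
Proof.
move=> hJ JI JT; elim/(strict_ind wo) => v IH vw.
have {}IH u : lt u v -> (greedy hle J u <-> T u).
  by move=> uv; apply: IH => //; apply: (strict_trans wo) vw.
split=> [|/greedyP[Tv nv]]; first exact: JT.
apply/greedyP; rewrite /reducible (below_agree IH); split.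
  by apply: (reachable_agree hle) Tv => u /IH[].
by case=> y [Ty Jy]; apply: nv; exists y; split=> //; apply: JI.
Qed.

Lemma early_agree J w : right_ideal J -> J `<=` I ->
  (forall v h, lt v w -> boundary_elt v h -> J h) ->
  forall v, lt v w -> (greedy hle J v <-> T v).
Proof.
move=> hJ JI Jw; apply: greedy_agree => // v vw IH /greedyP[].
rewrite /reducible (below_agree IH) => Tv nv; apply/greedyP; split.
  by apply: (reachable_agree hle) Tv => u /IH[].
case=> y [Ty Iy]; apply: nv; exists y; split=> //; apply: (Jw v) => //.
by apply: reducible_boundary => //; apply: (reachable_agree hle) Tv.
Qed.

(** Let [w] be the head of [f]. Below [w] the transversals of [J] and [I] agree: at a first
    disagreement [v] the boundary element of [v] would be a candidate smaller than [f]. So [f] is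
    the boundary element of [w], and it is outside [J], which contains [early_ideal w]. *)
Lemma exposed_basis_elt J f : right_ideal J -> J `<=` I ->
  exposed le I (greedy hle J) f -> exists w, basis_elt w f.
Proof.
move=> hJ JI [[If [w [[fw fmax] fw1]] Jf] fmin].
have agree : forall v, lt v w -> (greedy hle J v <-> T v).
  apply: greedy_agree => // v vw IH /[dup] Jv /greedyP[Tv _]; apply/greedyP.
  have {}Tv : reachable T v by apply: (reachable_agree hle) Tv.
  split=> // -[y [Ty Iy]]; have bg := reducible_boundary Tv Ty Iy.
  have [gv gmax] := boundary_elt_head bg.
  have wNg : w \notin msupp (E v - y : A).
    by apply/negP => /gmax; apply: (strictNle wo).
  (* Minimality of [f] gives a word [x] of [E v - y] with [w] at most [x], yet [x] is at most [v],
     which precedes [w]. *)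
  have [|E'|x [_ xg xmax]] := fmin (E v - y).
  - split=> //; first by exists v; split=> //; apply: boundary_elt_coef.
    move=> u /(boundary_elt_supp bg)[-> //|[Tu uv]]; exact/IH.
  - by rewrite E' fw in wNg.
  - apply: (strictNle wo vw); apply: (wo_trans wo) (gmax _ xg).
    by apply: xmax; rewrite in_fsetU !in_fsetD fw wNg.
exists w; split.
  split=> //.
    have /greedyP[Tw _] := Jf w fw; apply: (reachable_agree hle) Tw => v vw.
    exact: agree.
  apply/supportedP => v; rewrite mcoeffBA mcoeff_elt.
  have [<-|wv] := eqVneq w v; first by rewrite fw1 subrr eqxx.
  rewrite subr0 mcoeff_neq0 => fv.
  have vw : lt v w by rewrite /strict fmax // eq_sym.
  by split=> //; apply/agree/Jf.
have f0 : f <> 0 by move=> f0; move/eqP: fw1; rewrite f0 mcoeff0 eq_sym oner_eq0.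
have nJf : ~ J f by move=> /(greedy_independent hJ Jf).
(* A boundary word [v] before [w] is reducible modulo [J], and by uniqueness this relation is the
   boundary element of [v]. *)
apply: contra_not nJf; apply: early_ideal_sub_of => // v h vw bh.
have nJv : ~ greedy hle J v by move=> /agree -/(_ vw); apply: boundary_notin bh.
have [Tv _ _] := bh.
have [|//|[y [Jy Jvy]]] := @greedy_reduce _ _ _ hle J v.
  apply: (reachable_agree hle) Tv => u uv; apply: iff_sym.
  by apply: agree; apply: (strict_trans wo) vw.
suff -> : h = E v - y by [].
apply: boundary_elt_uniq bh _; apply: reducible_boundary => //; last exact: JI.
suff <- : below (greedy hle J) v = below T v by [].
by apply: below_agree => u uv; apply: agree; apply: (strict_trans wo) vw.
Qed.

End ExposureBasis.

(** * The exposure basis consists of the basis elements and generates *)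

Section ExposureProcess.
Variables (K : fieldType) (S : finType).
Local Notation F := (free_group S).
Local Notation A := (group_algebra F K).
Local Notation E := (@group_elt K S).
Variable le : rel F.
Hypothesis hle : exposure_order le.
Local Notation lt := (strict le).
Variable I : set A.
Hypothesis hI : right_ideal I.
Implicit Types (J : set A) (f g h x y : A) (u v w : F).
Local Notation wo := (exposure_wo hle).
Local Notation T := (greedy hle I).
Local Notation basis_elt := (basis_elt hle I).
Local Notation boundary_elt := (boundary_elt hle I).

(** Compare heads with a candidate [g]: a smaller head makes [g] an element of [I] supported on [T],
    hence 0; an equal head makes [g = h] by uniqueness; a larger head is the maximum of the
    symmetric difference. *)
Lemma exposed_basis_elt_early J w h : right_ideal J -> J `<=` I ->
  (forall v g, lt v w -> boundary_elt v g -> J g) ->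
  boundary_elt w h -> ~ J h -> exposed le I (greedy hle J) h.
Proof.
move=> hJ JI Jw bh nJ; have agree := early_agree hJ JI Jw.
have [hw hmax] := boundary_elt_head bh; have [Tw Ih Th] := bh.
have beq : below le (greedy hle J) w = below le T w by apply: below_agree.
have Jrw : greedy hle J w.
  apply/greedyP; split.
    by apply: (reachable_agree hle) Tw => v vw; apply: iff_sym; apply: agree.
  rewrite /reducible beq => -[y [Ty Jy]]; apply: nJ.
  suff -> : h = E w - y by [].
  apply: boundary_elt_uniq bh _ => //; apply: reducible_boundary => //.
  exact: JI.
split.
  split=> //; first by exists w; split=> //; apply: boundary_elt_coef bh.
  by move=> v /(boundary_elt_supp bh)[-> //|[Tv vw]]; apply/agree.
move=> g [Ig [w' [[gw' gmax] g1]] Jg] ne.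
have Tg v : v \in msupp g -> lt v w -> T v by move=> gv vw; apply/agree/Jg.
case: (strict_total wo w' w) => [w'w|w'E|ww'].
- have g0 : g = 0.
    apply: (greedy_independent (hle := hle) hI) => // v gv; apply: Tg => //.
    exact: (le_strict_trans wo) (gmax v gv) w'w.
  by rewrite g0 msupp0 in gw'.
- case: ne; congr msupp; subst w'; apply: boundary_elt_uniq (bh) => //.
  split=> //; apply/supportedP => v; rewrite mcoeffBA mcoeff_elt.
  have [<-|wv] := eqVneq w v; first by rewrite g1 subrr eqxx.
  rewrite subr0 mcoeff_neq0 => gv.
  have vw : lt v w by rewrite /strict gmax // eq_sym.
  by split=> //; apply: Tg.
- have hw' : w' \notin msupp h by apply/negP => /hmax; apply: (strictNle wo).
  exists w'; split=> // v; rewrite in_fsetU !in_fsetD => /orP[|] /andP[_].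
    by move=> /hmax vw; case/andP: ww' => ww' _; apply: (wo_trans wo) vw ww'.
  exact: gmax.
Qed.

Lemma exposure_basis_sub x : exposure_basis le I x -> exists w, basis_elt w x.
Proof.
case=> W [leW [f [_ proc [a _ <-]]]].
have [_] := proc a; set J := right_ideal_gen _.
have hJ : right_ideal J by apply: right_ideal_genP.
rewrite (min_Schreier_transversalE hle hJ); apply: exposed_basis_elt => //.
apply: right_ideal_gen_sub => // _ [b _ <-].
by have [_ [[]]] := proc b.
Qed.

(** A single process exposes all basis elements, indexed by their head words in the order [le]. At
    each stage the ideal contains the earlier boundary elements and lies in the early ideal, so the
    next basis element is still missing. *)
Lemma sub_exposure_basis w x : basis_elt w x -> exposure_basis le I x.
Proof.
move=> bx; pose W := {w | exists h, basis_elt w h}.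
pose leW (a b : W) := le (sval a) (sval b).
have fP (a : W) : {h | basis_elt (sval a) h} by apply: cid; case: a.
pose f a := sval (fP a); have bf a : basis_elt (sval a) (f a) := svalP (fP a).
have uniq_f a h : basis_elt (sval a) h -> f a = h.
  by case=> bh _; have [bfa _] := bf a; apply: boundary_elt_uniq bfa bh.
have val_injW (a b : W) : sval a = sval b -> a = b.
    by apply: eq_sig_hprop => *; apply: Prop_irrelevance.
exists W, leW, f; split; last first.
- by exists (exist _ w (ex_intro _ x bx)) => //; apply: uniq_f.
- move=> a; set J := right_ideal_gen _; set w' := sval a.
  have hJ : right_ideal J by apply: right_ideal_genP.
  have [bfa nfa] := bf a.
  have JI : J `<=` I.
    by apply: right_ideal_gen_sub => // _ [b _ <-]; have [[]] := bf b.
  have Jw v g : lt v w' -> boundary_elt v g -> J g.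
    apply: boundary_in_span => // {}v h vw bh.
    pose b : W := exist _ v (ex_intro _ h bh).
    apply: sub_right_ideal_gen; exists b; last exact: uniq_f.
    split=> [|ba]; first by case/andP: vw.
    by move: vw; rewrite /w' -ba; apply: strict_irr.
  have nJ : ~ J (f a).
    apply: contra_not nfa; apply: smallest_sub; first exact: right_ideal_genP.
    move=> _ [b [ba ne] <-]; apply: sub_right_ideal_gen.
    exists (sval b); split; last by case: (bf b).
    by rewrite /strict; apply/andP; split=> //; apply/eqP => /val_injW.
  split; first by move=> JE; apply: nJ; rewrite JE; case: bfa.
  rewrite (min_Schreier_transversalE hle hJ).
  exact: exposed_basis_elt_early bfa nJ.
- move=> P [a Pa].
  have [m [[b Pb <-] mmin]] :=
    @wo_min _ _ wo [set sval b | b in [set b | b \in P]] _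
      (ex_intro2 _ _ a Pa erefl).
  exists b; split=> [|c [Pc cmin]].
    by split=> // c Pc; apply: mmin; exists c.
  have bc : le (sval b) (sval c) by apply: mmin; exists c.
  have cb : le (sval c) (sval b) := cmin b Pb.
  by apply: val_injW; apply: (wo_anti wo); rewrite bc cb.
Qed.

(** The ideal of [X] contains all boundary elements, so it reduces any [f] to some [y] supported on
    [T]; for [f] in [I] this [y] is in [I], hence 0. *)
Lemma basis_elt_generates X : (forall w h, basis_elt w h -> X h) -> X `<=` I ->
  right_ideal_gen X = I.
Proof.
move=> BX XI; have hX := right_ideal_genP X.
have gI : right_ideal_gen X `<=` I by apply: right_ideal_gen_sub.
apply/seteqP; split=> // f If.
have bX w h : boundary_elt w h -> right_ideal_gen X h.
  move=> bh.
  have [Jh|nJ] := pselect (early_ideal hle I w h).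
    apply: early_ideal_sub_of Jh => // v g.
    apply: boundary_in_span => // {}v {}g _ bg.
    by apply: sub_right_ideal_gen; apply: BX bg.
  by apply: sub_right_ideal_gen; apply: (BX w).
have [|y [Ty Xy]] := @span_reachable _ _ _ hX T f (@greedy_closed _ _ _ hle I).
  move=> v Tv; have [Tv'|nTv] := pselect (T v).
    exists (E v); split; first exact: supported_elt.
    by rewrite subrr; case: hX.
  have [h bh] := boundary_exists Tv nTv; exists (E v - h); split; last first.
    by rewrite subKr; apply: bX bh.
  have [_ _ Th] := bh; rewrite -opprB; apply: supportedN.
  by apply: supported_sub Th; apply: below_sub.
suff y0 : y = 0 by rewrite y0 subr0 in Xy.
apply: (greedy_independent (hle := hle) hI) => //.
by rewrite -[y](subKr f); apply: right_idealB => //; apply: gI.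
Qed.

End ExposureProcess.

(** * Freeness *)

(** The derivation evaluates [lam] only at right multiples of [x], which stay in [I]. *)
Lemma tderiv_eq0 (K : fieldType) (S : finType) (R : algType K)
    (E : free_group S -> R) a (lam : {linear R -> K^o}) (I : set R) :
  right_ideal I -> (forall x, I x -> lam x = 0) ->
  forall w x, I x -> tderiv E a lam w x = 0.
Proof.
move=> [_ _ IM] lamI w; rewrite /tderiv; elim: (fword w) => //= b s IHs x Ix.
have -> : letter_deriv E a lam b x = 0.
  rewrite /letter_deriv; case: ifP => _; first by rewrite lamI // scale0r.
  case: ifP => // _; rewrite lamI ?scale0r ?oppr0 //; exact: IM.
by rewrite mul0r add0r IHs //; apply: IM.
Qed.

Section Freeness.
Variables (K : fieldType) (S : finType).
Local Notation F := (free_group S).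
Local Notation A := (group_algebra F K).
Local Notation E := (@group_elt K S).
Variable le : rel F.
Hypothesis hle : exposure_order le.
Local Notation lt := (strict le).
Variable I : set A.
Hypothesis hI : right_ideal I.
Implicit Types (f g h x y : A) (u v w : F).
Local Notation wo := (exposure_wo hle).
Local Notation T := (greedy hle I).
Local Notation basis_elt := (basis_elt hle I).
Local Notation boundary_elt := (boundary_elt hle I).
Local Notation early_ideal := (early_ideal hle I).

(** Replacing each boundary word of [f] through its boundary element, which is early, gives [z] on
    [T] congruent to [f] modulo the early ideal. Independence of [T] modulo [I] forces [y = z]. *)
Lemma early_reduce w f y :
  (forall v, v \in msupp f -> T v \/ reachable T v /\ lt v w) ->
  supported_on T y -> I (y - f) -> early_ideal w (y - f).
Proof.
move=> Zf Ty Iyf; have hJ : right_ideal (early_ideal w) := right_ideal_genP _.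
have [J0 JD _] := hJ.
have [z [Tz Jz]] : exists z, supported_on T z /\ early_ideal w (f - z).
  rewrite [f]group_algebraE big_seq.
  apply: (big_ind (fun g => exists z, supported_on T z /\ early_ideal w (g - z))).
  - by exists 0; rewrite subr0; split=> //; apply: supported0.
  - move=> g h [z [Tz Jz]] [z' [Tz' Jz']]; exists (z + z').
    by split; [exact: supportedD|rewrite opprD addrACA; apply: JD].
  - move=> v vf.
    have [z [Tz Jz]] : exists z, supported_on T z /\ early_ideal w (E v - z).
      have [Tv|nTv] := pselect (T v).
        by exists (E v); rewrite subrr; split=> //; apply: supported_elt.
      have [//|[Tv vw]] := Zf v vf.
      have [h bh] := boundary_exists Tv nTv.
      have [z [Tz _ hE]] := boundary_reducible bh; exists z; split.
        by apply: supported_sub Tz; apply: below_sub.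
      by rewrite -hE; apply: sub_right_ideal_gen; exists v.
    exists (f@_v *: z); split; first exact: supportedZ.
    by rewrite -scalerBr; exact: (right_idealZ _ hJ Jz).
suff -> : y = z by rewrite -opprB; exact: (right_idealN hJ Jz).
apply/eqP; rewrite -subr_eq0; apply/eqP.
apply: (greedy_independent (hle := hle) hI); first exact: supportedB.
have -> : y - z = (y - f) + (f - z) by rewrite addrA subrK.
by have [_ ID _] := hI; apply: ID => //; apply: (early_ideal_sub hI Jz).
Qed.

Lemma supported_mul_elt (Z : set F) f u : supported_on Z f ->
  supported_on [set (v * u)%g | v in Z] (f * E u).
Proof.
move=> Zf; rewrite [f]group_algebraE mulr_suml.
apply: supported_sum => v /Zf Zv; rewrite -scalerAl -group_eltM.
by apply: supportedZ; apply: supported_elt; exists v.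
Qed.

Section LastLetter.
Variables (w p : F) (a : letter S) (h : A).
Hypotheses (wE : w = (p * gen a)%g) (fwE : fword w = rcons (fword p) a).
Hypothesis bh : basis_elt w h.

(** Start points of the [a]-edges crossed, in either direction, by the prefix paths to words of [T]
    and to boundary words before [w]. The word [p] is excluded, as [w] is neither in [T] nor before
    itself. *)
Definition early_edge : set F :=
  [set v | [/\ T v \/ T (v * gen a)%g, T v \/ lt v w &
               T (v * gen a)%g \/ lt (v * gen a)%g w]].

Lemma last_parent : T p.
Proof. by have [[Tw _ _] _] := bh; exact: reachable_parent fwE Tw. Qed.

(* Otherwise [p], hence [w = p a], would be a consequence of the relations      *)
(* exposed before [w].                                                          *)
Lemma last_parent_free f :
  supported_on early_edge f -> ~ I (E p - f).
Proof.
move=> Xf Ipf; have [[Tw Ih Th] nJh] := bh; apply: nJh.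
have [y [Ty _ hE]] := boundary_reducible bh.1.
have hJ : right_ideal (early_ideal w) := right_ideal_genP _.
have [_ JD JM] := hJ.
have [_ ID IM] := hI.
have cT := @greedy_closed _ _ _ hle I.
(* Both [f] and [f a] involve only words of [T] and boundary words before [w]; so [h] is a
   difference of two elements of the early ideal. *)
have Jpf : early_ideal w (E p - f).
  apply: early_reduce => //; last by apply: supported_elt; exact: last_parent.
  move=> v /Xf[[Tv|Tva] [Tv'|vw] _]; [by left|by left|by left|right; split=> //].
  by rewrite -(mul_gen_linv v a); apply: reachable_mul_gen.
have Ea : (E p - f) * E (gen a) = E w - f * E (gen a).
  by rewrite mulrBl -group_eltM wE.
have Jya : early_ideal w (y - f * E (gen a)).
  apply: early_reduce.
  - move=> v vf; have [x [Tx _ Txa] <-] := supported_mul_elt Xf vf.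
    have [Txa'|nTxa] := pselect (T (x * gen a)%g); first by left.
    case: Tx Txa => // Tx [//|xaw]; right; split=> //.
    exact: reachable_mul_gen.
  - by apply: supported_sub Ty; apply: below_sub.
  - have -> : y - f * E (gen a) = (E p - f) * E (gen a) - h.
      by rewrite Ea hE opprB [RHS]addrC addrA subrK.
    by apply: (right_idealB hI) => //; apply: IM.
rewrite hE.
have -> : E w - y = (E p - f) * E (gen a) - (y - f * E (gen a)).
  by rewrite Ea opprB addrA subrK.
by apply: (right_idealB hJ) => //; apply: JM.
Qed.

Lemma last_letter_free c : early_ideal w (h * c) -> c = 0.
Proof.
move=> Jhc.
pose U := [set f : A | exists g, supported_on early_edge g /\ I (f - g)].
have [I0 ID IM] := hI; have cT := @greedy_closed _ _ _ hle I.
have IU f : I f -> U f.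
  by move=> If; exists 0; rewrite subr0; split=> //; apply: supported0.
have XU v : early_edge v -> U (E v).
  by move=> Xv; exists (E v); rewrite subrr; split=> //; apply: supported_elt.
have [||||lam [lamU lam1]] := @separating_functional K A U (E p).
- exact: IU.
- move=> f g [f' [Xf If]] [g' [Xg Ig]]; exists (f' + g'); split.
    exact: supportedD.
  by rewrite opprD addrACA; apply: ID.
- move=> k f [f' [Xf If]]; exists (k *: f'); split; first exact: supportedZ.
  by rewrite -scalerBr; apply: right_idealZ.
- by move=> [f [Xf /(last_parent_free Xf)]].
have lamI f : I f -> lam f = 0 by move/IU/lamU.
have lamX v : early_edge v -> lam (E v) = 0 by move/XU/lamU.
pose D := @tderiv K S A E a lam.
have [phi phiE] := @group_algebra_extension K S A (fun v => D v 1).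
(* By the product rule, crossing the edge from [q] to [q b] adds a term only if [b] is [a] or its
   inverse, and then a multiple of [lam] at [q], resp. [q b], which is in [early_edge]. *)
have step v q b : v = (q * gen b)%g -> T q -> T v \/ lt v w -> phi (E q) = 0 ->
    phi (E v) = 0.
  move=> -> Tq Tv; rewrite !phiE /D => q0.
  rewrite (tderiv_mul (group_elt1 K S) (@group_eltM K S)) q0 mul0r add0r mul1r.
  rewrite tderiv_gen /letter_deriv; case: eqP => [ba|_].
    by rewrite lamX ?scale0r //; rewrite ba in Tv; split; [left|left|].
  case: eqP => [ba|//]; rewrite -group_eltM lamX ?scale0r ?oppr0 //.
  have va : (q * gen b * gen a = q)%g by rewrite ba -{2}[a]linvK mul_gen_linv.
  by split; rewrite ?va //; [right|left].
have phi1 : phi (E 1%g) = 0 by rewrite phiE.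
have phiT v : T v -> phi (E v) = 0.
  elim/word_ind: v => // q b qb IHq Tv.
  have Tq : T q by apply: cT Tv; have [] := fprefix_parent qb.
  by apply: (step _ q b) => //; [left|apply: IHq].
have phi_supp y : supported_on T y -> phi y = 0.
  move=> Ty; rewrite [y]group_algebraE linear_sum big_seq big1 // => v /Ty Tv.
  by rewrite linearZ /= phiT // scaler0.
have phiM f g : I f -> phi (f * g) = phi f * g.
  move=> If; apply: (twisted_derivation_morph (group_elt1 K S)
    (@group_eltM K S) (@group_algebra_ind K S) _ phiE).
  by move=> v; apply: tderiv_eq0 If.
have phiJ : early_ideal w `<=` [set f | I f /\ phi f = 0].
  apply: smallest_sub => [|g [v [vw bg]]].
    split=> [|f g [If f0] [Ig g0]|f g [If f0]].
    - by rewrite /= linear0.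
    - by split; [apply: ID|rewrite linearD f0 g0 addr0].
    - split; first exact: IM.
      by rewrite phiM ?f0 ?mul0r.
  have [Tv Ig _] := bg; split=> //.
  have [y [Ty _ ->]] := boundary_reducible bg; rewrite linearB (phi_supp y).
    rewrite subr0; have [-> //|[q [b [vE fvE]]]] := fword_last v.
    have Tq : T q by apply: reachable_parent fvE Tv.
    by apply: (step _ q b) => //; [right|apply: phiT].
  by apply: supported_sub Ty; apply: below_sub.
have [_] := phiJ _ Jhc.
have [_ Ih _] := bh.1.
rewrite (phiM _ _ Ih).
(* Here [phi] kills the part of [h] on [T], so [phi h = phi w = phi p * a + lam p = 1], with [p] in
   [T]. *)
suff -> : phi h = 1 by rewrite mul1r.
have [y [Ty _ ->]] := boundary_reducible bh.1.
rewrite linearB (phi_supp y); last first.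
  by apply: supported_sub Ty; apply: below_sub.
rewrite subr0 wE phiE /D (tderiv_mul (group_elt1 K S) (@group_eltM K S)).
have := phiT _ last_parent; rewrite phiE /D => ->.
by rewrite mul0r add0r mul1r tderiv_gen /letter_deriv eqxx lam1 scale1r.
Qed.

End LastLetter.

End Freeness.

(** The empty word has no last letter and is treated apart: nothing precedes it, so [h = 1] and the
    early ideal is 0. *)
Lemma basis_elt_free (K : fieldType) (S : finType) (le : rel (free_group S))
    (hle : exposure_order le) (I : set (group_algebra (free_group S) K)) w h c :
  right_ideal I -> basis_elt hle I w h -> early_ideal hle I w (h * c) -> c = 0.
Proof.
move=> hI bh; have [w1|[p [a [wE fwE]]]] := fword_last w; last first.
  exact: (last_letter_free hI wE fwE bh).
subst w; have no_lt v : ~ strict le v 1%g.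
  move/(strictNle (exposure_wo hle)); apply; apply: (proj2 hle).
  exact: prefix0s.
have h1 : h = 1.
  apply/eqP; rewrite -subr_eq0; apply/eqP/malgP => v; rewrite mcoeff0.
  apply/eqP; rewrite mcoeff_eq0; apply/negP => hv.
  have [[_ _ Th] _] := bh; rewrite group_elt1 in Th.
  exact: no_lt (proj2 (Th v hv)).
have zI : right_ideal [set 0 : group_algebra (free_group S) K].
  split=> [|x y|x y]; rewrite /set1 /=.
  - by [].
  - by move=> -> ->; rewrite addr0.
  - by move=> ->; rewrite mul0r.
have := @right_ideal_gen_sub _ (early_gens hle I 1%g) _ zI _ (h * c).
by rewrite h1 mul1r; apply=> // g [v [/no_lt]].
Qed.

Lemma basis_elt_right_free (K : fieldType) (S : finType)
    (le : rel (free_group S)) (hle : exposure_order le)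
    (I : set (group_algebra (free_group S) K)) (B : set _) :
  right_ideal I -> (forall x, B x -> exists w, basis_elt hle I w x) ->
  right_free B.
Proof.
move=> hI Bb s c us sB sum0 b0 b0s; apply: contrapT => cb0.
pose hd x := xget 1%g [set w | basis_elt hle I w x].
have hdP x : x \in s -> basis_elt hle I (hd x) x.
  by move=> /sB/Bb/xgetPex; apply.
have b0s' : hd b0 \in [seq hd x | x <- s & c x != 0].
  by apply: map_f; rewrite mem_filter b0s andbT; apply/eqP.
(* Choose [b] with the largest head among the nonzero coefficients; distinct basis elements have
   distinct heads, so the other terms lie in its early ideal. *)
have [_ [/mapP[b bs' ->] bmax]] := wo_max_seq (exposure_wo hle) b0s'.
move: bs'; rewrite mem_filter => /andP[cb bs].
have hJ : right_ideal (early_ideal hle I (hd b)) := right_ideal_genP _.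
move/eqP: cb; apply; apply: (basis_elt_free hI (hdP b bs)).
move: sum0; rewrite (bigD1_seq b) //= => /eqP; rewrite addr_eq0 => /eqP ->.
apply: (right_idealN hJ); have [J0 JD JM] := hJ; rewrite big_seq_cond.
apply: (big_ind (early_ideal hle I (hd b))) => // x /andP[xs xb].
have [->|cx] := eqVneq (c x) 0; first by rewrite mulr0.
apply: JM; apply: sub_right_ideal_gen; exists (hd x).
have [bx _] := hdP x xs; split=> //; rewrite /strict bmax /=; last first.
  by apply: map_f; rewrite mem_filter cx.
apply: contra_neq xb => hdE; rewrite hdE in bx.
by have [bb _] := hdP b bs; apply: (boundary_elt_uniq hI bx bb).
Qed.

Theorem theorem1p3 (K : fieldType) (S : finType)
    (le : rel (free_group S)) (hle : exposure_order le)
    (I : set (group_algebra (free_group S) K)) (hI : right_ideal I) :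
  right_basis (exposure_basis le I) I.
Proof.
have Bb := exposure_basis_sub hle hI; split.
  apply: (basis_elt_generates (hle := hle) hI) => [w h|x /Bb[w [[]]]//].
  exact: sub_exposure_basis.
exact: (basis_elt_right_free (hle := hle) hI).
Qed.
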